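(* Let $n\ge1$, $e\ge 0$ and $t>1$ be integers, $q=(2e+1)t$, and suppose that $(e,q)$ is an $n$-maximal pair. Let $G=\mathbb{Z}_{d_1}\times\cdots\times\mathbb{Z}_{d_n}$ with positive integers $d_1\mid d_2\mid\cdots\mid d_n$. Then $G$ is an $(n,e,q)$-admissible structure if and only if $d_1d_2\cdots d_n=t^n$ and $d_n\mid q$.
   Context: For $a\in\mathbb{Z}_q$ with representative $\tilde a\in\{0,\dots,q-1\}$ put $|a|_1=\min\{\tilde a,q-\tilde a\}$. The maximum metric on $\mathbb{Z}_q^n$ is $d(x,y)=\max_i|x_i-y_i|_1$, and $B(x,r)=\{y\in\mathbb{Z}_q^n: d(x,y)\le r\}$. $LPL^{\infty}(n,e,q)$ is the set of linear perfect codes with packing radius $e$, i.e. of subgroups $C$ of $(\mathbb{Z}_q^n,+)$ with $\#C>1$ such that $\mathbb{Z}_q^n$ is the disjoint union of the balls $B(c,e)$, $c\in C$. $G$ is an $(n,e,q)$-admissible structure if there exists $C\in LPL^{\infty}(n,e,q)$ with $C\simeq G$ as abelian groups. Sections: for $I\subseteq[n]=\{1,\dots,n\}$ let $H_I=\{x\in\mathbb{Z}_q^n:x_i=0\ \forall i\in I\}$, let $\pi_I:\mathbb{Z}_q^n\to\mathbb{Z}_q^n$ be the homomorphism that sets the coordinates in $I$ to $0$ and keeps the others, $B(H_I,e)=\bigcup_{h\in H_I}B(h,e)$, and $C\langle I\rangle=\pi_I(B(H_I,e)\cap C)$. Ordered codes: a code $D\subseteq\mathbb{Z}_q^n$ is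 of type $i$ if $D+(2e+1)e_i\subseteq D$ ($e_i$ the $i$-th canonical vector), and $\tau(D)=\max\{i: D\text{ is of type }i\}$. For $C\in LPL^{\infty}(n,e,q)$ define $\wp_1=\tau(C)$, $J_1=\{\wp_1\}$, $C_1=C\langle J_1\rangle$, and for $1\le i<n$, $\wp_{i+1}=\tau(C_i)$, $J_{i+1}=J_i\cup\{\wp_{i+1}\}$, $C_{i+1}=C\langle J_{i+1}\rangle$. (By the Minkowski–Hajós theorem these are well defined and $(\wp_1,\dots,\wp_n)$ is a permutation of $[n]$.) $C$ is ordered if $(\wp_1,\dots,\wp_n)=(n,n-1,\dots,2,1)$. $LPL^{\infty}(n,e,q)_o$ is the set of ordered codes in $LPL^{\infty}(n,e,q)$. Maximality: the pair $(e,q)$ is $n$-maximal if $\#LPL^{\infty}(n,e,q)_o=(2e+1)^{\binom n2}$ (which is the largest possible value). *)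

(* Defs.v *)
From mathcomp Require Import all_boot all_order all_algebra all_fingroup.

Set Implicit Arguments.
Unset Strict Implicit.
Unset Printing Implicit Defensive.

Import GRing.Theory.

Local Open Scope nat_scope.

(* For 1 < q, 'Z_q is the ring of integers modulo q and its coercion to nat
   gives the representative in {0, ..., q - 1}. 'Z_0 and 'Z_1 both denote Z/2,
   so the definitions below carry their intended meaning only for 1 < q. *)
Notation vecZ n q := 'rV['Z_q]_n.

Section Metric.

Variables n q : nat.
Implicit Types (x y : vecZ n q) (r : nat).

Definition abs1 (a : 'Z_q) : nat := minn a (q - a).

Definition dist_max x y : nat := \max_(i < n) abs1 ((x - y)%R ord0 i).

Definition ball x r : {set vecZ n q} := [set y | dist_max x y <= r].

End Metric.

Section Codes.

Variables n e q : nat.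
Implicit Types (C D : {set vecZ n q}) (I : {set 'I_n}).

Definition perfect C : bool :=
  [forall c in C, forall c' in C,
     (c != c') ==> [disjoint ball c e & ball c' e]]
  && (\bigcup_(c in C) ball c e == [set: vecZ n q]).

(* The group law of the finGroupType 'rV['Z_q]_n is vector addition, so
   {group vecZ n q} is the type of additive subgroups. *)
Definition LPL : {set {group vecZ n q}} :=
  [set C : {group vecZ n q} | (1 < #|C|) && perfect C].

Definition Hset I : {set vecZ n q} :=
  [set x : vecZ n q | [forall i in I, x ord0 i == 0%R]].

Definition proj I (x : vecZ n q) : vecZ n q :=
  (\row_i (if i \in I then 0 else x ord0 i))%R.

Definition ball_Hset I : {set vecZ n q} := \bigcup_(h in Hset I) ball h e.

Definition code_section C I : {set vecZ n q} :=
  proj I @: (ball_Hset I :&: C).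

Definition of_type (i : 'I_n) D : bool :=
  [forall x in D, (x + delta_mx ord0 i *+ (2 * e + 1))%R \in D].

(* The coordinate i : 'I_n is the paper's coordinate i.+1, and tau takes its
   values in {1, ..., n}; it is 0 when D is of no type at all. *)
Definition tau D : nat := \max_(i < n | of_type i D) i.+1.

(* The pair (C_k, J_k), started at (C, set0) for k = 0. *)
Fixpoint section_chain C (k : nat) : {set vecZ n q} * {set 'I_n} :=
  if k is k'.+1 then
    let: (D, J) := section_chain C k' in
    let J' := J :|: [set j : 'I_n | j.+1 == tau D] in
    (code_section C J', J')
  else (C, set0).

(* wp C k is the number wp_k, meaningful for 1 <= k <= n. *)
Definition wp C (k : nat) : nat := tau (section_chain C k.-1).1.

Definition ordered C : bool := [forall k : 'I_n, wp C k.+1 == n - k].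

Definition LPLo : {set {group vecZ n q}} :=
  [set C in LPL | ordered (C : {group vecZ n q})].

Definition maximal_pair : Prop := #|LPLo| = (2 * e + 1) ^ 'C(n, 2).

Definition admissible (gT : finGroupType) (G : {group gT}) : Prop :=
  exists2 C : {group vecZ n q}, C \in LPL & C \isog G.

End Codes.

(* Z_{d 1} x ... x Z_{d n}: Zp m is the cyclic group of order m for every
   m >= 1, including the trivial group for m = 1 (whereas 'Z_1 is Z/2). *)
Definition Zprod (n : nat) (d : nat -> nat) :
    {group {dffun forall i : 'I_n, 'Z_(d i.+1)}} :=
  [group of setXn (fun i : 'I_n => Zp (d i.+1))].

(* Main.v *)
Require Import Defs.
From mathcomp Require Import all_boot all_order all_algebra all_fingroup.
From mathcomp Require Import all_solvable zify ring.

(** Necessity is counting.  A ball of radius [e] has [(2 * e + 1) ^ n] points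
    because [2 * e + 1 <= q], and [C] is perfect exactly when every vector is
    [c + b] for a unique codeword [c] and a unique [b] in the ball around 0
    ([perfectP]); so [#|C| * (2 * e + 1) ^ n = q ^ n], which gives
    [#|C| = t ^ n].  The exponent of the product of the [Z_(d i)] is a multiple
    of [d n], and the exponent of a subgroup of [Z_q ^ n] divides [q].

    Sufficiency builds a code with prescribed group structure.  Put
    [M = 2 * e + 1] and [h i = q / d i]; the two conditions on [d] say that the
    [h i] are integers with product [M ^ n].  For an invertible matrix [V] over
    [Z_q], the row module of [diag h *m V] is isomorphic to the product of the
    ideals [h i * Z_q], hence to the product of the [Z_(d i)]
    ([embed_Zprod]): the group is prescribed by [h], and [V] remains free.  On
    the other hand, the row module of a triangular matrix with [M] all along
    the diagonal meets every ball of radius [e], since the coordinates can be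
    corrected one after the other, each to the nearest multiple of [M]
    ([trig_covering]).  With [t ^ n] elements it is then perfect.

    The two descriptions are reconciled by a fact about integer matrices
    ([exists_trig_equiv]): any [A] with [|det A| = M ^ n] is equivalent, by
    unimodular row and column operations, to a triangular matrix with diagonal
    [M, ..., M].  In Smith normal form the first invariant factor divides [M]
    and [M] divides the last one, because [M ^ n] is the product of [n] factors
    forming a divisibility chain.  Operating on these two factors alone brings
    [M] to a corner ([corner_move]), and induction deals with the complementary
    block. *)

Set Implicit Arguments.
Unset Strict Implicit.
Unset Printing Implicit Defensive.

Import GRing.Theory.

Local Open Scope ring_scope.

(** * Integer matrices of determinant a power *)

Lemma unit_absz (x : int) : x \is a GRing.unit -> `|x|%N = 1%N.
Proof. by rewrite qualifE /= => /orP[] /eqP->. Qed.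

(** When [D] is diagonal, [r] and [l] are the coordinate vectors of one of its
    entries [M * b], and everything happens in two dimensions: with
    [h0 * a = M], the matrix [diag(h0, M * b)] is equivalent to
    [[M, 0], [- h0, h0 * b]].  Describing the entry through [r] and [l] keeps
    the computation at the level of blocks. *)
Lemma corner_move (R : comUnitRingType) (n : nat) (h0 a b M : R) (D : 'M[R]_n)
    (l : 'cV[R]_n) (r : 'rV[R]_n) :
  r *m l = 1 -> h0 * a = M -> r *m D = (M * b) *: r -> D *m l = (M * b) *: l ->
  exists U V : 'M[R]_(1 + n), [/\ U \in unitmx, V \in unitmx &
    exists c A', U *m block_mx h0%:M 0 0 D *m V = block_mx M%:M 0 c A'].
Proof.
move=> rl h0a rD Dl.
have lrK : l *m r *m l = l by rewrite -mulmxA rl mulmx1.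
have lrK' : l *m r *m (l *m r) = l *m r by rewrite mulmxA lrK.
pose U := block_mx a%:M r (- l) (1%:M - l *m r).
pose U' := block_mx 0 (- r) l (1%:M + (a - 1) *: (l *m r)).
pose V := block_mx (1%:M : 'M_1) (- b *: r) 0 1%:M.
pose V' := block_mx (1%:M : 'M_1) (b *: r) 0 1%:M.
have U'U : U' *m U = 1%:M.
  rewrite mulmx_block [RHS]scalar_mx_block.
  congr block_mx.
  + by rewrite mul0mx add0r mulNmx mulmxN opprK rl.
  + by rewrite mul0mx add0r mulmxBr mulmx1 mulNmx mulmxA rl mul1mx subrr.
  + rewrite mul_mx_scalar mulmxN mulmxDl mul1mx -scalemxAl lrK.
    by rewrite scalerBl scale1r addrCA subrr addr0 subrr.
  + rewrite mulmxDl mul1mx mulmxBr mulmx1 -scalemxAl lrK' subrr addr0.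
    by rewrite addrCA subrr addr0.
have VV' : V *m V' = 1%:M.
  rewrite mulmx_block [RHS]scalar_mx_block.
  congr block_mx.
  + by rewrite mulmx0 addr0 mulmx1.
  + by rewrite mul1mx mulmx1 scaleNr subrr.
  + by rewrite mul0mx mulmx0 addr0.
  + by rewrite mul0mx mulmx1 add0r.
exists U, V; split.
- by have [] := mulmx1_unit U'U.
- by have [] := mulmx1_unit VV'.
exists (- h0 *: l), (D - (M * b) *: (l *m r) + (h0 * b) *: (l *m r)).
rewrite !mulmx_block !(mulmx0, mulmx1, mul0mx, addr0, add0r) rD.
rewrite -scalar_mxM [a * h0]mulrC h0a mul_mx_scalar scaleNr.
rewrite mulmxBl mul1mx -mulmxA rD -scalemxAr.
congr block_mx.
- by rewrite mulmxN mul_scalar_mx scalerA addNr.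
- by rewrite scalerN scaleNr.
by rewrite scalerN mulNmx mulmxN opprK -scalemxAl -scalemxAr scalerA addrC.
Qed.

(** Once [M] stands in a corner with zeros beside it, the complementary block has
    determinant [M ^ n] up to sign, because unimodular operations preserve
    [|det A|]; so the induction only has to produce one such corner. *)
Lemma exists_trig_equiv (n M : nat) (A : 'M[int]_n) :
  (0 < M)%N -> `|\det A|%N = (M ^ n)%N ->
  exists U V : 'M[int]_n, [/\ U \in unitmx, V \in unitmx,
    is_trig_mx (U *m A *m V) & forall i, (U *m A *m V) i i = M%:Z].
Proof.
move=> M0; elim: n A => [|n IHn] A detA.
  exists 1%:M, 1%:M; rewrite !unitmx1; split=> //; last by case.
  by rewrite flatmx0 mx0_is_trig.
suff [U [V [Uu Vu [c [A' E]]]]] : exists U V : 'M_(1 + n),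
    [/\ U \in unitmx, V \in unitmx &
      exists c A', U *m A *m V = block_mx (M%:Z)%:M 0 c A'].
  have detA' : `|\det A'|%N = (M ^ n)%N.
    have := congr1 (fun B : 'M_(1 + n) => `|\det B|%N) E.
    rewrite (@det_lblock int 1 n) det_scalar1 !det_mulmx !abszM detA.
    move: (Uu) (Vu); rewrite !unitmxE => /unit_absz-> /unit_absz->.
    rewrite mul1n muln1 expnS => /eqP.
    by rewrite eqn_pmul2l // => /eqP.
  have [U' [V' [U'u V'u T D]]] := IHn A' detA'.
  exists (block_mx 1%:M 0 0 U' *m U), (V *m block_mx 1%:M 0 0 V').
  have E' : block_mx 1%:M 0 0 U' *m U *m A *m (V *m block_mx 1%:M 0 0 V') =
      block_mx (M%:Z)%:M 0 (U' *m c) (U' *m A' *m V').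
    rewrite -!mulmxA [U *m _]mulmxA [U *m A *m _]mulmxA E !mulmx_block.
    by rewrite !(mulmx0, mulmx1, mul0mx, mul1mx, addr0, add0r) !mulmxA.
  split.
  - by rewrite unitmx_mul Uu andbT unitmxE (@det_lblock int 1 n) det1 mul1r.
  - by rewrite unitmx_mul Vu unitmxE (@det_lblock int 1 n) det1 mul1r.
  - by rewrite E' (@is_trig_block_mx _ 1 n 1 n) // eqxx T mx11_is_trig.
  - move=> i; rewrite E' -[i](@splitK 1 n); case: (split _) => j /=.
      by rewrite (@block_mxEul _ 1 n 1 n) !ord1 mxE eqxx.
    by rewrite (@block_mxEdr _ 1 n 1 n) D.
(* [d] may be shorter than the diagonal: entries beyond its end read as 0,
   which every integer divides. *)
have [L Lu [R Ru [d sd AE]]] := int_Smith_normal_form A.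
set H := (\matrix_(_, _) _) in AE.
have detH : (\prod_(i < n.+1) `|(d`_i)%R| = M ^ n.+1)%N.
  have Ht : is_trig_mx H.
    by apply/is_trig_mxP => i j ij; rewrite mxE (ltn_eqF ij) mulr0n.
  move: Lu Ru detA; rewrite AE !det_mulmx !abszM !unitmxE.
  move=> /unit_absz-> /unit_absz->; rewrite mul1n muln1 => <-.
  rewrite det_trig //.
  rewrite (big_morph absz abszM (erefl : `|1%:Z|%N = 1%N)).
  by apply: eq_bigr => i _; rewrite mxE eqxx mulr1n.
have dvd_d i j : (i <= j)%N -> (`|(d`_i)%R| %| `|(d`_j)%R|)%N.
  move=> ij; have [le|lt] := leqP (size d) j.
    by rewrite (nth_default _ le).
  have := sorted_leq_nth dvdz_trans dvdzz 0 sd.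
  by move=> /(_ i j); rewrite !inE lt (leq_ltn_trans ij lt) => /(_ isT isT ij).
(* Compare [M ^ n.+1], the product of all factors, with the [n.+1]-st power of
   the smallest and of the largest one. *)
have d0M : (d`_0 %| M%:Z)%Z.
  rewrite dvdzE -(@dvdn_pexp2r _ _ n.+1) // -detH.
  rewrite -[X in (_ ^ X)%N]card_ord -prod_nat_const.
  apply: (big_ind2 (fun x y => x %| y)%N) => // [*|i _]; first exact: dvdn_mul.
  exact: dvd_d.
have Mdn : (M%:Z %| d`_n)%Z.
  rewrite dvdzE -(@dvdn_pexp2r _ _ n.+1) // -detH.
  rewrite -[X in (_ ^ X)%N]card_ord -prod_nat_const.
  apply: (big_ind2 (fun x y => x %| y)%N) => // [*|i _]; first exact: dvdn_mul.
  by rewrite dvd_d // -ltnS.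
have [U [V [Uu Vu E]]] : exists U V : 'M_(1 + n),
    [/\ U \in unitmx, V \in unitmx &
      exists c A', U *m H *m V = block_mx (M%:Z)%:M 0 c A'].
  (* When [n = 0] the first and last factors coincide: only a sign to fix. *)
  case: n {IHn A detA L Lu R Ru AE} @H detH d0M Mdn => [|n] H detH d0M Mdn.
    exists (sgz d`_0)%:M, 1%:M; rewrite unitmx1 mulmx1 unitmxE det_scalar1.
    move: detH; rewrite big_ord1 expn1 => detH.
    have d0 : d`_0 != 0 by rewrite -absz_gt0 detH.
    split=> //; first by rewrite sgz_def d0 qualifE /=; case: (_ < _).
    exists 0, 0; apply/matrixP => i j.
    rewrite -[i](@splitK 1 0) -[j](@splitK 1 0).
    case: (split i) => [i'|[]//]; case: (split j) => [j'|[]//] /=.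
    rewrite (@block_mxEul _ 1 0 1 0) !ord1 mul_scalar_mx /H !mxE eqxx !mulr1n /=.
    by rewrite -abszEsg -detH.
  have [a dE] := dvdzP d0M; have [b dnE] := dvdzP Mdn.
  pose D : 'M[int]_n.+1 := \matrix_(i, j) (d`_i.+1 *+ (i == j :> nat)).
  have HE : H = block_mx ((d`_0)%:M : 'M_1) 0 0 D.
    apply/matrixP => i j; rewrite -[i](@splitK 1 n.+1) -[j](@splitK 1 n.+1).
    case: (@split 1 n.+1 i) => i'; case: (@split 1 n.+1 j) => j' /=.
    - by rewrite (@block_mxEul _ 1 n.+1 1 n.+1) !ord1 !mxE.
    - by rewrite (@block_mxEur _ 1 n.+1 1 n.+1) !ord1 !mxE.
    - by rewrite (@block_mxEdl _ 1 n.+1 1 n.+1) !ord1 !mxE.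
    - by rewrite (@block_mxEdr _ 1 n.+1 1 n.+1) !mxE.
  have [] := @corner_move _ n.+1 d`_0 a b M%:Z D
    (delta_mx ord_max 0) (delta_mx 0 ord_max).
  - by rewrite mul_delta_mx; apply/matrixP => i j; rewrite !ord1 !mxE.
  - by rewrite mulrC.
  - rewrite -rowE mulrC -dnE; apply/rowP => j; rewrite !mxE /= mulr_natr.
    by rewrite [n == j]eq_sym.
  - rewrite -colE mulrC -dnE; apply/colP => i; rewrite !mxE /= andbT.
    rewrite mulr_natr -[i == ord_max]/(i == n :> nat).
    by have [->|//] := eqVneq (i : nat) n.
  by move=> U [V UV]; exists U, V; rewrite HE.
exists (U *m invmx L), (invmx R *m V).
rewrite !unitmx_mul !unitmx_inv Uu Vu Lu Ru; split=> //.
by rewrite AE !mulmxA mulmxKV // -!mulmxA; rewrite mulKVmx // mulmxA.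
Qed.

(** * Balls and perfect codes *)

Section Balls.

Variables (e q : nat).
Hypothesis (q1 : (1 < q)%N).

Lemma ltn_Zp (a : 'Z_q) : (a < q)%N.
Proof. by rewrite -[X in (_ < X)%N](Zp_cast q1) ltn_ord. Qed.

(** The window [-e, e] written as a translate of [0, 2 * e], so that its
    elements are counted by ordinals. *)
Lemma abs1P (a : 'Z_q) :
  reflect (exists2 k : nat, (k <= 2 * e)%N & a = k%:R - e%:R) (abs1 a <= e)%N.
Proof.
have aq := ltn_Zp a.
apply: (iffP idP) => [|[k ke ->]].
  rewrite /abs1 geq_min => /orP[ae|ae].
    by exists (a + e)%N; [lia | rewrite natrD natr_Zp addrK].
  exists (a + e - q)%N; first by lia.
  have [le|lt] := leqP q (a + e).
    by rewrite natrB // pchar_Zp // subr0 natrD natr_Zp addrK.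
  by lia.
have [le|lt] := leqP e k.
  rewrite -natrB // /abs1 val_Zp_nat // geq_min (leq_trans (leq_mod _ _)) //.
  by lia.
have -> : k%:R - e%:R = (q - (e - k) %% q)%:R :> 'Z_q.
  rewrite natrB; last by rewrite ltnW // ltn_mod ltnW.
  by rewrite pchar_Zp // sub0r Zp_nat_mod // natrB ?opprB // ltnW.
rewrite /abs1 val_Zp_nat // geq_min.
have [->|r0] := posnP ((e - k) %% q); first by rewrite subn0 modnn.
have rq : ((e - k) %% q < q)%N by rewrite ltn_mod ltnW.
have re := leq_mod (e - k) q.
by rewrite modn_small; [apply/orP; right; lia | lia].
Qed.

Lemma card_abs1_le : (2 * e + 1 <= q)%N ->
  #|[set a : 'Z_q | (abs1 a <= e)%N]| = (2 * e + 1)%N.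
Proof.
move=> eq_le.
pose f (k : 'I_(2 * e + 1)) : 'Z_q := k%:R - e%:R.
have f_inj : injective f.
  move=> i j /addIr /(congr1 val); rewrite /= !val_Zp_nat // !modn_small.
  - exact: val_inj.
  - exact: leq_trans (ltn_ord j) eq_le.
  - exact: leq_trans (ltn_ord i) eq_le.
rewrite -[RHS]card_ord -cardsT -(card_imset setT f_inj).
apply: eq_card => a; rewrite inE; apply/abs1P/imsetP => [[k ke ->]|[k _ ->]].
  have ke' : (k < 2 * e + 1)%N by rewrite addn1 ltnS.
  by exists (Ordinal ke').
by exists k => //; have := ltn_ord k; lia.
Qed.

Lemma in_ball n (x y : vecZ n q) :
  (y \in ball x e) = [forall i, (abs1 ((x - y)%R ord0 i) <= e)%N].
Proof.
rewrite inE /dist_max; apply/bigmax_leqP/forallP => H i //; exact: H.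
Qed.

Lemma card_ball0 n : (2 * e + 1 <= q)%N ->
  #|ball (0 : vecZ n q) e| = ((2 * e + 1) ^ n)%N.
Proof.
move=> eq_le; rewrite -(card_abs1_le eq_le) -[X in (_ ^ X)%N]card_ord -card_ffun_on.
pose f (g : {ffun 'I_n -> 'Z_q}) : vecZ n q := - \row_i g i.
have f_inj : injective f.
  by move=> g h /oppr_inj /rowP gh; apply/ffunP => i; have := gh i; rewrite !mxE.
rewrite -(card_imset _ f_inj); apply: eq_card => x; rewrite in_ball sub0r.
apply/forallP/imsetP => [H|[g /ffun_onP gS ->] i].
  exists [ffun i => (- x) ord0 i].
    by apply/ffun_onP => i; rewrite ffunE inE.
  by apply/rowP => i; rewrite !mxE ffunE !mxE opprK.
by have := gS i; rewrite inE opprK mxE.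
Qed.

Lemma in_ball_shift n (x y : vecZ n q) :
  (y \in ball x e) = (y - x \in ball (0 : vecZ n q) e).
Proof. by rewrite !in_ball sub0r opprB. Qed.

(** The sum map from [C] times the ball around 0 to the whole space is injective
    when the balls are disjoint and surjective when they cover, so given one of
    the two, the other is an equality of cardinals. *)
Lemma perfectP n (C : {group vecZ n q}) : (2 * e + 1 <= q)%N ->
  reflect ((forall x, exists2 c, c \in C & x \in ball c e)
           /\ (#|C| * (2 * e + 1) ^ n = q ^ n)%N) (perfect e C).
Proof.
move=> eq_le.
pose f (z : vecZ n q * vecZ n q) := z.1 + z.2.
pose D := setX C (ball (0 : vecZ n q) e).
have cardD : #|D| = (#|C| * (2 * e + 1) ^ n)%N by rewrite cardsX card_ball0.
have cardT : #|[set: vecZ n q]| = (q ^ n)%N.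
  by rewrite cardsT card_mx mul1n card_ord Zp_cast.
have imf : (forall x, exists2 c, c \in C & x \in ball c e) -> f @: D = setT.
  move=> cov; apply/setP => x; rewrite inE; apply/imsetP.
  have [c cC xc] := cov x; exists (c, x - c); last by rewrite /f /= addrC subrK.
  by rewrite in_setX cC -in_ball_shift.
apply: (iffP andP) => [[/forall_inP disj /eqP cov]|[cov card_eq]]; last first.
  have /eqP/imset_injP f_inj : #|f @: D| = #|D|.
    by rewrite imf // cardT cardD.
  split; last first.
    apply/eqP/setP => x; rewrite inE; have [c cC xc] := cov x.
    by apply/bigcupP; exists c.
  apply/forall_inP => c cC; apply/forall_inP => c' c'C; apply/implyP => neq.
  apply/pred0P => y /=; apply: contraNF neq => /andP[yc yc'].
  have : (c, y - c) = (c', y - c').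
    apply: f_inj; rewrite ?in_setX ?cC ?c'C /= -?in_ball_shift //.
    by rewrite /f /= addrC subrK [RHS]addrC subrK.
  by case=> ->.
have cov' x : exists2 c, c \in C & x \in ball c e.
  by apply/bigcupP; rewrite cov inE.
split=> //; rewrite -cardD -cardT -(imf cov') card_in_imset //.
move=> [c b] [c' b']; rewrite !in_setX /= => /andP[cC b0] /andP[c'C b'0].
rewrite /f /= => E.
have cc' : c = c'.
  apply: contraTeq b0 => neq; apply/negP => b0.
  have /forall_inP/(_ _ c'C)/implyP/(_ neq)/pred0P/(_ (c + b)) := disj _ cC.
  by rewrite /= !(in_ball_shift _ (c + b)) {2}E ![_ + _ - _]addrC !addKr b0 b'0.
by move: E; rewrite -cc' => /addrI->.
Qed.

Lemma exists_close_multiple (a : 'Z_q) :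
  exists u : 'Z_q, (abs1 (u * (2 * e + 1)%:R - a)%R <= e)%N.
Proof.
(* Adding [e] before dividing turns rounding down into rounding to nearest. *)
exists ((a + e) %/ (2 * e + 1))%:R; apply/abs1P.
have := divn_eq (a + e) (2 * e + 1); set u := (_ %/ _)%N; set r := (_ %% _)%N => E.
have r_lt : (r < 2 * e + 1)%N by rewrite ltn_mod addn1.
exists (2 * e - r)%N; first exact: leq_subr.
have /(congr1 (fun k => k%:R : 'Z_q)) := E.
rewrite natrD natr_Zp natrD natrM => /(canRL (addrK _)) ->.
rewrite natrB; last by lia.
by rewrite (natrD _ (2 * e)) natrM; ring.
Qed.

(** Triangularity makes the last coordinates of [u *m T] independent of the first
    entry of [u], which is chosen last: it moves the first coordinate by an
    arbitrary multiple of [2 * e + 1]. *)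
Lemma trig_covering n (T : 'M['Z_q]_n) :
  is_trig_mx T -> (forall i, T i i = (2 * e + 1)%:R) ->
  forall x, exists u : vecZ n q, x \in ball (u *m T) e.
Proof.
move=> Tt; elim/trigsqmx_ind: n T / Tt => [|n m c T _ IH] diag x.
  by exists 0; rewrite in_ball; apply/forallP => -[].
have {}IH y : exists u : vecZ n q, y \in ball (u *m T) e.
  by apply: IH => i; rewrite -(diag (rshift 1 i)) block_mxEdr.
have [u' u'P] := IH (rsubmx (x : 'rV_(1 + n))).
have [u0 u0P] :=
  exists_close_multiple ((x : 'rV_(1 + n)) 0 (lshift n 0) - (u' *m c) 0 0).
exists (row_mx u0%:M u'); rewrite in_ball; apply/forallP => i.
rewrite (@mul_row_block _ 1 1 n 1 n) -[i](@splitK 1 n).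
rewrite mxE; case: (@split 1 n i) => j /=.
  rewrite (@row_mxEl _ 1 1 n) (ord1 j) mul_scalar_mx !mxE.
  have -> : m 0 0 = (2 * e + 1)%:R by rewrite -(diag (lshift n 0)) block_mxEul.
  by move: u0P; rewrite opprB addrA !mxE.
rewrite (@row_mxEr _ 1 1 n) mulmx0 add0r.
by move: u'P; rewrite in_ball => /forallP/(_ j); rewrite !mxE.
Qed.

End Balls.

(** * Embedding a product of cyclic groups *)

Section Embedding.

Variable q : nat.
Hypothesis (q1 : (1 < q)%N).

Section Cyclic.

Variables d h : nat.
Hypotheses (d0 : (0 < d)%N) (dh : (d * h = q)%N).

(** The embedding of the cyclic group of order [d] as the ideal generated by [h]
    in the integers modulo [q]; when [d = 1] it is injective on [Zp d] but not
    on the two-element type ['Z_d]. *)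
Definition Zp_scale (x : 'Z_d) : 'Z_q := (h * x)%:R.

Lemma Zp_scale_mod (k : nat) : (h * (k %% d))%:R = (h * k)%:R :> 'Z_q.
Proof. by rewrite muln_modr [X in (_ %% X)%N]mulnC dh Zp_nat_mod. Qed.

Lemma Zp_cases : (1 < d)%N \/ Zp d = 1%g.
Proof. by rewrite /Zp; case: ifP; [left | right]. Qed.

Lemma Zp_scaleM : {in Zp d &, {morph Zp_scale : x y / (x * y)%g >-> x + y}}.
Proof.
have [d1|->] := Zp_cases => x y.
  move=> _ _; rewrite /Zp_scale -natrD -mulnDr /=.
  by rewrite [X in (_ %% X)%N](Zp_cast d1) Zp_scale_mod.
by move=> /set1gP-> /set1gP->; rewrite mulg1 /Zp_scale muln0 addr0.
Qed.

Lemma Zp_scale_inj : {in Zp d &, injective Zp_scale}.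
Proof.
have [d1|->] := Zp_cases => x y; last by move=> /set1gP-> /set1gP->.
have h0 : (0 < h)%N by case: h dh (q1) => // <-; rewrite muln0.
have lt (z : 'Z_d) : (h * z < q)%N.
  by rewrite -dh mulnC ltn_pmul2r // -[X in (_ < X)%N](Zp_cast d1) ltn_ord.
move=> _ _ /(congr1 val); rewrite /= !val_Zp_nat // !modn_small //.
by move/eqP; rewrite eqn_pmul2l // => /eqP/val_inj.
Qed.

Lemma Zp_scale_surj (w : 'Z_q) : exists2 x, x \in Zp d & Zp_scale x = w * h%:R.
Proof.
have [d1|Z1] := Zp_cases.
  exists w%:R; first exact: mem_Zp.
  by rewrite /Zp_scale val_Zp_nat // Zp_scale_mod natrM natr_Zp mulrC.
exists 1%g; first by rewrite Z1 group1.
have -> : h = q by rewrite -dh -(card_Zp d0) Z1 cards1 mul1n.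
by rewrite pchar_Zp // mulr0 /Zp_scale muln0.
Qed.

End Cyclic.

End Embedding.

(** The group is mapped to the product of the ideals [h i * Z_q], then moved by
    the automorphism [V] of the ambient space. *)
Lemma embed_Zprod n q d (V : 'M['Z_q]_n) (h : 'I_n -> nat) : (1 < q)%N ->
  (forall i, 1 <= i <= n -> 0 < d i)%N ->
  (forall i : 'I_n, d i.+1 * h i = q)%N ->
  V \in unitmx ->
  exists2 C : {group vecZ n q}, C \isog Zprod n d &
    forall w : vecZ n q, w *m diag_mx (\row_i (h i)%:R) *m V \in C.
Proof.
move=> q1 d0 dh Vu.
pose f (x : {dffun forall i : 'I_n, 'Z_(d i.+1)}) : vecZ n q :=
  (\row_i Zp_scale q (h i) (x i)) *m V.
have d0' (i : 'I_n) : (0 < d i.+1)%N by rewrite d0 /=.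
have fM : {in Zprod n d &, {morph f : x y / (x * y)%g >-> (x * y)%g}}.
  move=> x y /setXnP xG /setXnP yG; rewrite /f FinRing.zmodMgE -mulmxDl.
  congr (_ *m _).
  by apply/rowP => i; rewrite !mxE -(Zp_scaleM q1 (dh i) (xG i) (yG i)) mulg_ffun.
pose fm := Morphism fM.
have injf : ('injm fm)%g.
  apply/injmP => x y /setXnP xG /setXnP yG /(can_inj (mulmxK Vu)) /rowP E.
  apply/ffunP => i; have := E i; rewrite !mxE.
  exact: (Zp_scale_inj q1 (dh i) (xG i) (yG i)).
exists (fm @* Zprod n d)%G; first by rewrite isog_sym sub_isog.
move=> w.
have xP (i : 'I_n) : {x : 'Z_(d i.+1) | x \in Zp (d i.+1) &
    Zp_scale q (h i) x == w ord0 i * (h i)%:R}.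
  apply: sig2W; have [x xZ xE] := Zp_scale_surj q1 (d0' i) (dh i) (w ord0 i).
  by exists x => //; apply/eqP.
pose x : {dffun forall i : 'I_n, 'Z_(d i.+1)} := [ffun i => s2val (xP i)].
have xG : x \in Zprod n d
  by apply/setXnP => i; rewrite ffunE; exact: (s2valP (xP i)).
have -> : w *m diag_mx (\row_i (h i)%:R) *m V = fm x.
  congr (_ *m _); apply/rowP => i; rewrite mul_mx_diag !mxE ffunE.
  by rewrite (eqP (s2valP' (xP i))).
exact: mem_morphim.
Qed.

(** * Order and exponent *)

Lemma prod_ord_succ n (F : nat -> nat) :
  (\prod_(i < n) F i.+1 = \prod_(1 <= i < n.+1) F i)%N.
Proof. by rewrite big_add1 big_mkord. Qed.

Lemma card_Zprod n d :
  (forall i, 1 <= i <= n -> 0 < d i)%N ->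
  #|Zprod n d| = (\prod_(i < n) d i.+1)%N.
Proof.
move=> d0; rewrite cardsXn; apply: eq_bigr => i _.
by rewrite card_Zp // d0 //=.
Qed.

Lemma exponent_Zprod n d (i : 'I_n) :
  (forall i, 1 <= i <= n -> 0 < d i)%N -> (d i.+1 %| exponent (Zprod n d))%N.
Proof.
move=> d0; have := exponent_morphim (dffun_morphism _ i) (Zprod n d).
rewrite morphim_dffunXn; apply: dvdn_trans.
rewrite exponent_cyclic; first by rewrite card_Zp // d0 /=.
rewrite /= /Zp; case: ifP => _; last exact: cyclic1.
by rewrite Zp_cycle cycle_cyclic.
Qed.

Lemma exponent_vecZ n q (C : {group vecZ n q}) : (1 < q)%N ->
  (exponent C %| q)%N.
Proof.
move=> q1; apply/exponentP => x _; rewrite FinRing.zmodXgE; apply/rowP => i.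
by rewrite mulmxnE -mulr_natr pchar_Zp // mulr0 mxE.
Qed.

(** * Admissible structures *)

Theorem theorem5p34 (n e t q : nat) (d : nat -> nat)
    (hn : (1 <= n)%N) (ht : (1 < t)%N) (hq : q = ((2 * e + 1) * t)%N)
    (hmax : maximal_pair n e q)
    (hdpos : forall i : nat, (1 <= i <= n)%N -> (0 < d i)%N)
    (hdvd : forall i : nat, (1 <= i < n)%N -> (d i %| d i.+1)%N) :
  admissible n e q (Zprod n d) <->
  (\prod_(1 <= i < n.+1) d i)%N = (t ^ n)%N /\ (d n %| q)%N.
Proof.
have q1 : (1 < q)%N by nia.
have eq_le : (2 * e + 1 <= q)%N by nia.
have M0 : (0 < 2 * e + 1)%N by rewrite addn1.
rewrite -prod_ord_succ; split=> [[C]|[prod_d dn_q]].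
  rewrite inE => /andP[_ /(perfectP q1 _ eq_le)[_ cardC]] isoCG; split.
    rewrite -card_Zprod // -(card_isog isoCG).
    have Mn0 : (0 < (2 * e + 1) ^ n)%N by rewrite expn_gt0 M0.
    by apply/eqP; rewrite -(eqn_pmul2r Mn0) cardC -expnMn mulnC -hq.
  have n_lt : (n.-1 < n)%N by rewrite prednK.
  have := exponent_Zprod (Ordinal n_lt) hdpos; rewrite /= prednK // => dvd.
  rewrite (dvdn_trans dvd) // -(exponent_isog isoCG); exact: exponent_vecZ.
have d_q (i : 'I_n) : (d i.+1 %| q)%N.
  apply: dvdn_trans dn_q; have : (i.+1 <= n)%N by [].
  have : (0 < i.+1)%N by []; move: i.+1 => k k0 kn.
  suff dvd m : (k + m <= n)%N -> (d k %| d (k + m))%N.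
    by rewrite -(subnKC kn) dvd // subnKC.
  elim: m => [|m IH] km; first by rewrite addn0.
  rewrite addnS in km *; apply: dvdn_trans (IH (ltnW km)) _.
  by rewrite hdvd // addn_gt0 k0.
pose h (i : 'I_n) := (q %/ d i.+1)%N.
have dh (i : 'I_n) : (d i.+1 * h i)%N = q by rewrite mulnC divnK.
have detH : `|\det (diag_mx (\row_i (h i)%:Z))|%N = ((2 * e + 1) ^ n)%N.
  rewrite det_diag (big_morph absz abszM (erefl : `|1%:Z|%N = 1%N)).
  have tn0 : (0 < t ^ n)%N by rewrite expn_gt0 ltnW.
  apply/eqP; rewrite -(eqn_pmul2r tn0) -expnMn -hq -prod_d -big_split /=.
  under eq_bigr => i _ do rewrite mxE absz_nat mulnC dh.
  by rewrite prod_nat_const card_ord.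
have [U [V [Uu Vu Tt Td]]] := exists_trig_equiv M0 detH.
pose toZq := map_mx (intmul (1 : 'Z_q)) : 'M_n -> 'M_n.
have toZqu A : A \in unitmx -> toZq A \in unitmx.
  by rewrite !unitmxE det_map_mx; exact: rmorph_unit.
have [C isoCG CP] := embed_Zprod q1 hdpos dh (toZqu _ Vu).
have cardC : #|C| = (t ^ n)%N by rewrite (card_isog isoCG) card_Zprod.
exists C => //; rewrite inE cardC.
rewrite -[X in (X < _)%N](exp1n n) ltn_exp2r // ht /=.
apply/(perfectP q1 _ eq_le); split; last by rewrite cardC -expnMn mulnC -hq.
move=> x; pose T := U *m diag_mx (\row_i (h i)%:Z) *m V.
have [|i|u xu] := @trig_covering e q q1 n (toZq T) _ _ x.
- by apply/is_trig_mxP => i j ij; rewrite mxE (is_trig_mxP Tt) ?rmorph0.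
- by rewrite mxE Td.
exists (u *m toZq T) => //.
have -> : u *m toZq T = (u *m toZq U) *m diag_mx (\row_i (h i)%:R) *m toZq V.
  rewrite /toZq !map_mxM map_diag_mx !mulmxA; congr (_ *m diag_mx _ *m _).
  by apply/rowP => i; rewrite !mxE.
exact: CP.
Qed.
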